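(* Let $X$ be a Tychonoff space, let $\aleph_\alpha\geq\aleph_1$ be a cardinal, and let $f\in C(X)$. Then the path component, the component and the quasicomponent of $f$ in the space $C_{\aleph_\alpha}(X)$ are all equal to $f+C^*(X)=\{f+g: g\in C^*(X)\}$.
   Context: Tychonoff means completely regular and Hausdorff. $C(X)$ is the set of all real-valued continuous functions on $X$ and $C^*(X)$ is the set of all bounded members of $C(X)$. The quasicomponent of a point is the intersection of all clopen sets containing it. For an infinite cardinal $\aleph_\alpha$, $\mathcal{A}_{\aleph_\alpha}=\{A\subseteq X: |A|<\aleph_\alpha\}$. For $f\in C(X)$, $A\in\mathcal{A}_{\aleph_\alpha}$ and real $\epsilon>0$ put $B(f,A,\epsilon)=\{g\in C(X): \sup_{x\in A}|f(x)-g(x)|<\epsilon\}$ (equal to $C(X)$ when $A=\emptyset$). The sets $B(f,A,\epsilon)$ form a base of a topology on $C(X)$; $C_{\aleph_\alpha}(X)$ denotes $C(X)$ with this topology. *)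

(* Defs.v *)
From HB Require Import structures.
From mathcomp Require Import all_boot all_order all_algebra.
From mathcomp Require Import all_classical all_reals all_analysis.

Set Implicit Arguments.
Unset Strict Implicit.
Unset Printing Implicit Defensive.

Import Order.TTheory GRing.Theory Num.Theory.
Import numFieldNormedType.Exports.

Local Open Scope classical_set_scope.
Local Open Scope card_scope.
Local Open Scope ring_scope.

Definition card_lt (T U : Type) (A : set T) (B : set U) : Prop :=
  A #<= B /\ ~ (A #= B).

(* There is no type of cardinals in the library: an infinite cardinal is given
   by an infinite type, and compared with sets through `#<=`, `#=`. *)
Record infinite_cardinal := InfiniteCardinal {
  cardinal_carrier :> Type;
  cardinal_infinite : infinite_set [set: cardinal_carrier]
}.

(* aleph_1 is the cardinal successor of aleph_0 = |nat|, so that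
   aleph_1 <= K means aleph_0 < K. *)
Definition aleph1_le (K : infinite_cardinal) : Prop :=
  card_lt [set: nat] [set: K].

Section cardinal_arithmetic.

Lemma card_le_relP (T U : Type) (A : set T) (B : set U) :
  A #<= B <-> exists G : T -> U -> Prop,
    (forall x, A x -> exists2 y, B y & G x y) /\
    (forall x x' y, G x y -> G x' y -> x = x').
Proof.
split=> [/card_leP[f]|[G [Gt Gi]]].
  exists (fun x y => exists2 a : A, x = val a & y = val (f a)); split.
    move=> x /mem_set Ax; exists (val (f (SigSub Ax))); first exact: set_valP.
    by exists (SigSub Ax).
  move=> _ _ y [a -> ->] [b ->] /val_inj fab; congr (val _).
  by apply: (@inj _ _ _ f); rewrite ?inE.
have H (a : A) : exists b : B, G (val a) (val b).
  by have [y /mem_set By Gay] := Gt _ (set_valP a); exists (SigSub By).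
have [f Hf] := choice H.
apply/card_leP/injfunPex; exists f => // a b _ _ fab.
by apply: val_inj; apply: (Gi _ _ (val (f a))) => //; rewrite fab.
Qed.

Lemma card_le_total (T U : Type) (A : set T) (B : set U) :
  A #<= B \/ B #<= A.
Proof.
pose P (G : set (T * U)) := [/\ forall p, G p -> A p.1 /\ B p.2,
  forall x y y', G (x, y) -> G (x, y') -> y = y' &
  forall x x' y, G (x, y) -> G (x', y) -> x = x'].
have [|G [[Gs Gf Gi] Gmax]] := @Zorn_bigcup _ P.
  move=> F FP Ftot; split.
  - by move=> p [G FG Gp]; have [+ _ _] := FP _ FG; apply.
  - move=> x y y' [G FG Gp] [G' FG' G'p].
    have [GG'|G'G] := Ftot _ _ FG FG'.
      by have [_ Gf _] := FP _ FG'; exact: Gf (GG' _ Gp) G'p.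
    by have [_ Gf _] := FP _ FG; exact: Gf Gp (G'G _ G'p).
  - move=> x y y' [G FG Gp] [G' FG' G'p].
    have [GG'|G'G] := Ftot _ _ FG FG'.
      by have [_ _ Gi] := FP _ FG'; exact: Gi (GG' _ Gp) G'p.
    by have [_ _ Gi] := FP _ FG; exact: Gi Gp (G'G _ G'p).
have [dG|/existsNP[x /not_implyP[Ax nGx]]] :=
    pselect (forall x, A x -> exists y, G (x, y)).
  left; apply/card_le_relP; exists (fun x y => G (x, y)); split=> // x /dG[y Gxy].
  by exists y => //; have [] := Gs _ Gxy.
have [rG|/existsNP[y /not_implyP[By nGy]]] :=
    pselect (forall y, B y -> exists x, G (x, y)).
  right; apply/card_le_relP; exists (fun y x => G (x, y)); split=> [y|].
    by move=> /rG[x' Gxy]; exists x' => //; have [] := Gs _ Gxy.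
  by move=> y y' x'; exact: Gf.
exfalso; apply: (Gmax ((x, y) |` G)).
  split; first by move=> ? ?; right.
  by move=> /(_ (x, y) (or_introl erefl)) Gxy; apply: nGx; exists y.
split.
- by move=> p [->//|/Gs].
- move=> a b b' [[-> ->]|Gab] [[]|Gab'] //.
  + by exfalso; apply: nGx; exists b'.
  + by move=> E1 E2; subst; exfalso; apply: nGx; exists b.
  + exact: Gf Gab Gab'.
- move=> a a' b [[-> ->]|Gab] [[]|Gab'] //.
  + by exfalso; apply: nGy; exists a'.
  + by move=> E1 E2; subst; exfalso; apply: nGy; exists a.
  + exact: Gi Gab Gab'.
Qed.

Lemma infinite_injection (T : Type) (A : set T) : infinite_set A ->
  exists2 e : nat -> T, (forall n, A (e n)) & injective e.
Proof.
move=> /infiniteP/card_le_relP[G [Gt Gi]].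
have /choice[e eP] (n : nat) : exists x, A x /\ G n x.
  by have [x Ax Gnx] := Gt n I; exists x.
exists e => [n|m n emn]; first by have [] := eP n.
by apply: (Gi _ _ (e m)); [have [] := eP m|rewrite emn; have [] := eP n].
Qed.

Lemma card_le_setU_finite (T : Type) (A F : set T) :
  infinite_set A -> finite_set F -> A `|` F #<= A.
Proof.
move=> /infinite_injection[e Ae ei] finF.
have /countable_injP[h hi] : countable (range e `|` F).
  rewrite -bigcup2E; apply: bigcup_countable => // -[|[|n]] _ //=.
    exact: card_image_le.
  exact: finite_set_countable.
apply/card_le_relP.
exists (fun x y => ((range e `|` F) x /\ y = e (h x)) \/
                   (~ (range e `|` F) x /\ y = x)); split.
  move=> x AFx; have [NFx|nNFx] := pselect ((range e `|` F) x).
    by exists (e (h x)) => //; left.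
  by exists x; [case: AFx => // Fx; exfalso; apply: nNFx; right|right].
move=> x x' y [[Nx ->]|[nNx ->]] [[Nx' E]|[nNx' E]] //.
- by apply: hi; rewrite ?inE//; exact: ei.
- by exfalso; apply: nNx'; rewrite -E; left; exists (h x).
- by exfalso; apply: nNx; rewrite E; left; exists (h x').
Qed.

Lemma card_le_double (T : Type) (A : set T) :
  infinite_set A -> A `*` [set: bool] #<= A.
Proof.
move=> infA.
pose dom (G : set (T * bool * T)) x := exists b y, G (x, b, y).
pose P (G : set (T * bool * T)) := [/\ dom G `<=` A,
  forall x b, dom G x -> exists y, G (x, b, y),
  forall p y, G (p, y) -> dom G y &
  forall p p' y, G (p, y) -> G (p', y) -> p = p'].
have domS (G G' : set (T * bool * T)) : G `<=` G' -> dom G `<=` dom G'.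
  by move=> GG' x [b [y Gx]]; exists b, y; exact: GG'.
have [|G [[GA Gt Gr Gi] Gmax]] := @Zorn_bigcup _ P.
  move=> F FP Ftot; split.
  - move=> x [b [y [G FG Gx]]]; have [GA _ _ _] := FP _ FG.
    by apply: GA; exists b, y.
  - move=> x b [c [z [G FG Gx]]]; have [_ Gt _ _] := FP _ FG.
    have [|y Gy] := Gt x b; first by exists c, z.
    by exists y, G.
  - move=> p y [G FG Gp]; have [_ _ Gr _] := FP _ FG.
    by apply: domS (Gr _ _ Gp); exact: bigcup_sup.
  - move=> p p' y [G FG Gp] [G' FG' G'p].
    have [GG'|G'G] := Ftot _ _ FG FG'.
      by have [_ _ _ Gi] := FP _ FG'; exact: Gi (GG' _ Gp) G'p.
    by have [_ _ _ Gi] := FP _ FG; exact: Gi Gp (G'G _ G'p).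
have finD : finite_set (A `\` dom G).
  apply: contrapT => /infinite_injection[e eD ei].
  pose E : set (T * bool * T) := [set q | exists n (b : bool),
    q = (e n, b, e (b + n.*2)%N)].
  have dE n : dom (G `|` E) (e n).
    by exists true, (e (true + n.*2)%N); right; exists n, true.
  apply: (Gmax (G `|` E)).
    split; first by move=> q; left.
    move=> /(_ (e 0%N, false, e 0%N)) H; have [_] := eD 0%N; apply.
    by exists false, (e 0%N); apply: H; right; exists 0%N, false.
  split.
  - move=> x [b [y [Gx|[n [c [-> _ _]]]]]]; last by have [] := eD n.
    by apply: GA; exists b, y.
  - move=> x b [c [y [Gx|[n [d [-> _ _]]]]]].
      have [|z Gz] := Gt x b; first by exists c, y.
      by exists z; left.
    by exists (e (b + n.*2)%N); right; exists n, b.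
  - move=> p y [Gp|[n [d [_ ->]]]] //.
    by apply: domS (Gr _ _ Gp) => q; left.
  - move=> p p' y [Gp|[n [b [-> ->]]]] [Gp'|[m [c [-> E']]]].
    + exact: Gi Gp Gp'.
    + by subst y; have [_] := eD (c + m.*2)%N; case; exact: Gr Gp.
    + by have [_] := eD (b + n.*2)%N; case; exact: Gr Gp'.
    + move/ei: E' => E'; have nm : n = m.
        by rewrite -(half_bit_double n b) E' half_bit_double.
      by move: E'; rewrite nm => /addIn; case: b; case: c.
have infD : infinite_set (dom G).
  move=> fD; apply: infA.
  apply: sub_finite_set (_ : finite_set (dom G `|` A `\` dom G)).
    by move=> x Ax; have [|] := pselect (dom G x); [left|right].
  by rewrite finite_setU.
have AD : A #<= dom G.
  apply: card_le_trans (card_le_setU_finite infD finD).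
  apply: subset_card_le => x Ax.
  by have [|] := pselect (dom G x); [left|right].
have DA : dom G #<= A by exact: subset_card_le.
apply: card_le_trans DA.
have /card_le_relP[H [Ht Hi]] := AD.
apply/card_le_relP.
exists (fun p y => exists2 x, H p.1 x & G (x, p.2, y)); split.
  move=> [a b] [/= Aa _]; have [x dx Hax] := Ht _ Aa.
  have [y Gy] := Gt x b dx; exists y; first exact: Gr Gy.
  by exists x.
move=> [a b] [a' b'] y [x /= Hax Gx] [x' /= Hax' Gx'].
have [E ->] := Gi _ _ _ Gx Gx'; congr (_, _).
by apply: Hi Hax _; rewrite E.
Qed.

Lemma card_ltU (T : Type) (K : infinite_cardinal) (A B : set T) :
  card_lt A [set: K] -> card_lt B [set: K] -> card_lt (A `|` B) [set: K].
Proof.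
wlog AB : A B / A #<= B => [wlogAB AK BK|].
  have [AB|BA] := card_le_total A B; first exact: wlogAB.
  by rewrite setUC; exact: wlogAB.
move=> [AK nAK] [BK nBK].
have [finB|infB] := pselect (finite_set B).
  have finA : finite_set A by exact: card_le_finite finB.
  have finU : finite_set (A `|` B) by rewrite finite_setU.
  split; last by move=> /eq_finite_set E; apply: (@cardinal_infinite K); rewrite -E.
  apply: card_le_trans (finite_set_countable finU) _.
  exact/infiniteP/cardinal_infinite.
suff UB : A `|` B #= B.
  by split; [rewrite (card_le_eql UB)|rewrite (card_eql UB)].
rewrite card_eq_le; apply/andP; split; last first.
  by apply: subset_card_le; exact: subsetUr.
apply: card_le_trans (card_le_double infB).
have /card_le_relP[G [Gt Gi]] := AB.
apply/card_le_relP.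
exists (fun x p => (B x /\ p = (x, true)) \/
  [/\ A x, ~ B x, p.2 = false & G x p.1]); split.
  move=> x ABx; have [Bx|nBx] := pselect (B x).
    by exists (x, true) => //; left.
  have Ax : A x by case: ABx.
  have [y By Gxy] := Gt _ Ax.
  by exists (y, false) => //; right; split.
move=> x x' [y b] [[_ [-> ->]]|[_ _ /= -> Gx]] [[_ []]|[_ _ //= _ Gx']] //.
exact: Gi Gx Gx'.
Qed.

End cardinal_arithmetic.

Definition tychonoff_space (X : topologicalType) : Prop :=
  completely_regular_space X /\ hausdorff_space X.

Definition quasicomponent (T : topologicalType) (x : T) : set T :=
  \bigcap_(A in [set A : set T | clopen A /\ A x]) A.

Definition path_component (R : realType) (T : topologicalType) (x : T) : set T :=
  [set y | exists p : R -> T,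
    [/\ {within `[0, 1], continuous p}, p 0 = x & p 1 = y]].

(* An alias of C(X), tagged with the cardinal K so that it can carry the
   topology of the space C_K(X). *)
Definition Caleph (R : realType) (K : infinite_cardinal) (X : topologicalType) :
  Type := continuousType X R.

HB.instance Definition _ R K X :=
  Choice.copy (Caleph R K X) (continuousType X R).

Section Caleph_topology.
Variables (R : realType) (K : infinite_cardinal) (X : topologicalType).
Local Notation C := (Caleph R K X).

Definition small_sets : set (set X) := [set A | card_lt A [set: K]].

(* The supremum is taken in the extended reals: it may be +oo, and it is -oo
   for A = set0, in which case the set is all of C(X). *)
Definition Bset (f : C) (A : set X) (e : R) : set C :=
  [set g : C | (ereal_sup [set `|f x - g x|%:E | x in A] < e%:E)%E].

Definition Caleph_base : set (set C) :=
  [set U | exists f A e, [/\ small_sets A, 0 < e & U = Bset f A e]].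

Lemma small_sets0 : small_sets set0.
Proof.
split; first exact: card_ge0.
by move=> /eq_finite_set E; apply: (@cardinal_infinite K); rewrite -E.
Qed.

Lemma Caleph_base_cover : \bigcup_(U in Caleph_base) U = setT.
Proof.
apply/seteqP; split=> // f _; exists (Bset f set0 1).
  by exists f, set0, 1; split=> //; exact: small_sets0.
by rewrite /Bset /= image_set0 ereal_sup0 ltNyr.
Qed.

Lemma Bset_nbhs (f h : C) (A : set X) (e : R) : Bset f A e h ->
  exists2 d, 0 < d & forall D d', A `<=` D -> d' <= d ->
    Bset h D d' `<=` Bset f A e.
Proof.
rewrite /Bset /= => fh.
have [s [se fhs]] : exists s : R, s < e /\ forall x, A x -> `|f x - h x| <= s.
  have ub x : A x -> (`|f x - h x|%:E <=
      ereal_sup [set `|f x - h x|%:E | x in A])%E.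
    by move=> Ax; apply: ereal_sup_ubound; exists x.
  move: fh ub; case: ereal_sup => [s||] //=.
    by rewrite lte_fin => se ub; exists s.
  move=> _ ub; exists (e - 1); split; first by rewrite ltrBlDr ltrDl.
  by move=> x /ub.
exists ((e - s) / 2); first by rewrite divr_gt0// subr_gt0.
move=> D d' AD dd' g /= hg.
apply: (@le_lt_trans _ _ (s + (e - s) / 2)%:E); last first.
  by rewrite lte_fin -ltrBrDl ltr_pdivrMr// ltr_pMr ?subr_gt0// ltr1n.
apply: ge_ereal_sup => _ [x Ax <-]; rewrite lee_fin.
rewrite -(subrK (h x) (f x)) -addrA (le_trans (ler_normD _ _))// lerD ?fhs//.
rewrite (le_trans _ dd')// -lee_fin; apply: (le_trans _ (ltW hg)).
by apply: ereal_sup_ubound; exists x => //; exact: AD.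
Qed.

Lemma Caleph_base_join (U V : set C) (h : C) :
  Caleph_base U -> Caleph_base V -> U h -> V h ->
  exists W, [/\ Caleph_base W, W h & W `<=` U `&` V].
Proof.
move=> [f [A [e [KA _ ->]]]] [g [B [e' [KB _ ->]]]].
move=> /Bset_nbhs[d d0 dU] /Bset_nbhs[d' d'0 dV].
have m0 : 0 < Num.min d d' by rewrite lt_min d0.
exists (Bset h (A `|` B) (Num.min d d')); split.
- by exists h, (A `|` B), (Num.min d d'); split=> //; exact: card_ltU.
- rewrite /Bset /=; apply: (@le_lt_trans _ _ 0%:E); last by rewrite lte_fin.
  by apply: ge_ereal_sup => _ [x _ <-]; rewrite subrr normr0.
- move=> k Bk; split.
    by apply: (dU _ _ _ _ _ Bk); [left|rewrite ge_min lexx].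
  by apply: (dV _ _ _ _ _ Bk); [right|rewrite ge_min lexx orbT].
Qed.

HB.instance Definition _ := isBaseTopological.Build C
  Caleph_base_cover Caleph_base_join.

Definition Cstar : set (continuousType X R) :=
  [set g | bounded_fun (g : X -> R)].

Definition translate_Cstar (f : C) : set C :=
  [set h | exists2 g, Cstar g & (h : X -> R) = f \+ g].

End Caleph_topology.

(* Main.v *)
Require Import Defs.
From mathcomp Require Import all_boot all_order all_algebra.
From mathcomp Require Import all_classical all_reals all_analysis.
Import numFieldNormedType.Exports.
Local Open Scope classical_set_scope.

(* If g is bounded, then t |-> f + t g is a path in C_K(X) from f to f + g,
   because it is Lipschitz for the supremum norm.  Conversely, if h - f is
   unbounded, it is already unbounded on a countable set A; since A has fewer
   than K elements, uniform closeness on A defines an open condition, so the set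
   of all g with g - f bounded on A is clopen, and it separates f from h.  The
   three sets are thus squeezed between f + C^*(X) and itself by
   path component <= component <= quasicomponent. *)

Section Components.
Import Order.TTheory GRing.Theory Num.Theory.
Local Open Scope ring_scope.

(** A connected set [C] through [x] meets a clopen [A] containing [x] in a nonempty relatively
    clopen subset, which must be all of [C]. *)
Lemma connected_component_sub_quasicomponent {T : topologicalType} (x : T) :
  connected_component [set: T] x `<=` quasicomponent x.
Proof.
move=> y [C [Cx _ Cconn] Cy] A [[oA cA] Ax].
suff CA : C `&` A = C by move: Cy; rewrite -CA => -[].
by apply: Cconn; [exists x|exists A|exists A].
Qed.

Lemma path_component_sub_connected_component (R : realType)
    {T : topologicalType} (x : T) :
  path_component R x `<=` connected_component [set: T] x.
Proof.
move=> y [p [cp p0 p1]].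
have Ip (t : R) : 0 <= t <= 1 -> (p @` `[0, 1]) (p t).
  by move=> t01; exists t; rewrite //= in_itv.
apply: (@connected_component_max _ _ (p @` `[0, 1])) => //.
- by rewrite -p0; apply: Ip; rewrite lexx ler01.
- by apply: connected_continuous_connected => //; exact: segment_connected.
- by rewrite -p1; apply: Ip; rewrite ler01 lexx.
Qed.

End Components.

Section CalephTopology.
Import Order.TTheory GRing.Theory Num.Theory.
Local Open Scope ring_scope.
Local Open Scope card_scope.
Context {R : realType} {K : infinite_cardinal} {X : topologicalType}.
Local Notation C := (Caleph R K X).

(** Uncountability of [K] enters here: it lets countable sets serve as the [A] of a basic open set
    [Bset f A e]. *)
Lemma countable_small_sets (A : set X) :
  aleph1_le K -> countable A -> small_sets K A.
Proof.
move=> [NK nNK] cA; split; first exact: card_le_trans cA NK.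
move=> AK; apply: nNK; rewrite card_eq_le NK /=.
by rewrite -(card_le_eql AK).
Qed.

Lemma Bset_center (f : C) (A : set X) (e : R) : 0 < e -> Bset f A e f.
Proof.
move=> e0; rewrite /Bset /=; apply: (@le_lt_trans _ _ 0%:E); last first.
  by rewrite lte_fin.
by apply: ge_ereal_sup => _ [x _ <-]; rewrite subrr normr0.
Qed.

Lemma Bset_ltP (f g : C) (A : set X) (e : R) (x : X) :
  Bset f A e g -> A x -> `|f x - g x| < e.
Proof.
move=> fg Ax; rewrite -lte_fin; apply: le_lt_trans fg.
by apply: ereal_sup_ubound; exists x.
Qed.

(** A basic set need not be centred at [h], but by [Bset_nbhs] it contains one that is, over the
    same [A]. *)
Lemma nbhs_Bset (h : C) (U : set C) :
  nbhs h U <-> exists A d, [/\ small_sets K A, 0 < d & Bset h A d `<=` U].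
Proof.
split=> [|[A [d [sA d0 BU]]]]; rewrite nbhsE.
  (* The open set [V] is the union of a subfamily [D] of the base; [W] is a member of [D] containing
     [h]. *)
  move=> [V [[D Dsub VE] Vh] VU]; move: Vh; rewrite -VE => -[W DW Wh].
  have [f [A [e [sA e0 WE]]]] := Dsub _ DW.
  move: Wh; rewrite WE => /Bset_nbhs[d d0 dB].
  exists A, d; split=> // g /(dB A d (fun _ => id) (lexx d)) Bg.
  by apply: VU; rewrite -VE; exists W => //; rewrite WE.
exists (Bset h A d) => //; split; last exact: Bset_center.
exists [set Bset h A d]; last by rewrite bigcup_set1.
by move=> _ ->; exists h, A, d.
Qed.

(** Moving [g] by less than 1 on [A] changes a bound by at most 1. Closeness is symmetric, so both
    the set and its complement contain the [Bset] of radius 1 around each of their points. *)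
Lemma clopen_bounded_on (f : C) (A : set X) : small_sets K A ->
  clopen [set g : C | exists M : R, forall x, A x -> `|g x - f x| <= M].
Proof.
move=> sA; set U := [set _ | _].
have UB (g h : C) : Bset g A 1 h -> U g -> U h.
  move=> Bgh [M gM]; exists (1 + M) => x Ax.
  rewrite -(subrK (g x) (h x)) -addrA (le_trans (ler_normD _ _))// lerD ?gM//.
  by rewrite distrC ltW// (Bset_ltP _ _ _ _ _ Bgh).
have BC (g h : C) : Bset g A 1 h -> Bset h A 1 g.
  suff E : [set `|h x - g x|%:E | x in A] = [set `|g x - h x|%:E | x in A].
    by rewrite /Bset /= E.
  by apply: eq_imagel => x _; rewrite distrC.
split; last first.
  rewrite -openC openE => g nUg; apply/nbhs_Bset; exists A, 1; split=> // h.
  by move=> /BC /UB hg /hg.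
rewrite openE => g Ug; apply/nbhs_Bset; exists A, 1; split=> // h.
by move=> /UB; apply.
Qed.

Lemma unbounded_countable (u : X -> R) :
  ~ bounded_fun u ->
  exists2 A : set X, countable A &
    ~ exists M : R, forall x, A x -> `|u x| <= M.
Proof.
move=> nb.
have /choice[a ua] (n : nat) : exists x, n%:R < `|u x|.
  apply: contrapT => /forallNP un; apply: nb; exists n%:R.
  (* [bounded_fun] asks that every [M] above some real threshold be a bound; the threshold here is
     [n]. *)
  split=> [|M nM x _ /=]; first exact: realn.
  by rewrite (le_trans _ (ltW nM))// leNgt; apply/negP/un.
exists (range a); first exact: card_image_le.
move=> [M uM]; have [n Mn] : exists n : nat, M < n%:R.
  by exists (Num.truncn M).+1; exact: truncnS_gt.
have /uM := imageT a n; rewrite leNgt => /negP; apply.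
exact: lt_trans Mn (ua n).
Qed.

Lemma quasicomponent_sub_translate (f : C) : aleph1_le K ->
  quasicomponent f `<=` translate_Cstar f.
Proof.
move=> K1 h qh.
have cu : continuous ((h : X -> R) \- (f : X -> R)).
  by move=> x; apply: continuousB; exact: cts_fun.
exists (mkcts cu : continuousType X R); last first.
  by apply/funext => x; rewrite /mkcts /= addrC subrK.
apply: contrapT => /unbounded_countable[A cA]; apply.
(* This clopen set contains [f], so it contains [h], against the choice of [A]. *)
apply: (qh [set g : C | exists M : R, forall x, A x -> `|g x - f x| <= M]).
split; first exact/clopen_bounded_on/countable_small_sets.
by exists 0 => x _; rewrite subrr normr0.
Qed.

Lemma translate_sub_path_component (f : C) :
  translate_Cstar f `<=` path_component R f.
Proof.
move=> h [g /ex_strict_bound_gt0[M M0 gM] hfg].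
have cp (t : R) : continuous (fun x => f x + t * g x : R).
  move=> x; apply: continuousD; first exact: cts_fun.
  by apply: continuousM; [exact: cst_continuous|exact: cts_fun].
pose p (t : R) : C := (mkcts (cp t) : continuousType X R).
have pE t x : p t x = f x + t * g x by [].
exists p; split; last 2 first.
- by apply/continuousEP => x; rewrite pE mul0r addr0.
- by apply/continuousEP => x; rewrite pE hfg mul1r.
(* The path is continuous on all of [R], and the estimate below is uniform in [x], whatever [A]
   is. *)
apply: continuous_subspaceT => t U /nbhs_Bset[A [d [_ d0 dU]]].
(* With [M] bounding [g], this radius keeps each difference below [d / 2]; halving keeps the
   supremum strictly below [d]. *)
have dM : 0 < d / 2 / M by rewrite !divr_gt0.
apply: filterS (nbhsx_ballx t (d / 2 / M) dM) => s ts; apply: dU.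
rewrite /Bset /=; apply: (@le_lt_trans _ _ (d / 2)%:E); last first.
  by rewrite lte_fin ltr_pdivrMr// ltr_pMr// ltr1n.
apply: ge_ereal_sup => _ [x _ <-]; rewrite lee_fin !pE.
rewrite opprD addrACA subrr add0r -mulrBl normrM.
rewrite -[leRHS](divfK (lt0r_neq0 M0)) ler_pM//; first exact: ltW.
exact/ltW/gM.
Qed.

End CalephTopology.

Theorem corollary3p13 (R : realType) (X : topologicalType)
    (K : infinite_cardinal) (f : Caleph R K X) :
  tychonoff_space X -> aleph1_le K ->
  [/\ path_component R f = translate_Cstar f,
      connected_component [set: Caleph R K X] f = translate_Cstar f &
      quasicomponent f = translate_Cstar f].
Proof.
move=> _ K1.
have TP := @translate_sub_path_component R K X f.
have PC := @path_component_sub_connected_component R _ f.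
have CQ := @connected_component_sub_quasicomponent _ f.
have QT := quasicomponent_sub_translate f K1.
split; apply/seteqP; split=> h.
- by move=> /PC/CQ/QT.
- exact: TP.
- by move=> /CQ/QT.
- by move=> /TP/PC.
- exact: QT.
- by move=> /TP/PC/CQ.
Qed.
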